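(* Consider the fractional partial differential equation $$\sum_{i=1}^{m}\lambda_i\frac{\partial^{i\alpha}f(x,t)}{\partial t^{i\alpha}}=N[f(x,t)]=N\left(x,f,\frac{\partial^{\beta}f}{\partial x^{\beta}},\dots,\frac{\partial^{k\beta}f}{\partial x^{k\beta}}\right),\qquad(\ast)$$ where $N[f]$ is a linear or nonlinear differential operator, $\frac{\partial^{i\alpha}f}{\partial t^{i\alpha}}$ ($i=1,2,\dots,m$) and $\frac{\partial^{j\beta}f}{\partial x^{j\beta}}$ ($j=1,2,\dots,k$) are Caputo time and space derivatives respectively, of orders with $\alpha,\beta>0$, $\lfloor\alpha\rfloor=r$, $\lfloor\beta\rfloor=s$ where $r,s\in\mathbb{N}$, and $\lambda_i\in\mathbb{R}$. Let $\phi_1(x),\dots,\phi_n(x)$ be linearly independent functions. If the finite dimensional linear space $$I_{n}=\left\{\sum_{j=1}^{n}k_j\phi_j(x)\ \Big|\ k_1,\dots,k_n\in\mathbb{R}\right\}$$ is invariant under the operator $N$, then the equation $(\ast)$ has a solution of the form $$f(x,t)=\sum_{j=1}^{n}K_j(t)\phi_j(x),$$ where the coefficients $K_1,\dots,K_n$ satisfy the following system of fractional differential equations: $$\sum_{i=1}^{m}\lambda_i\frac{d^{i\alpha}K_j(t)}{dt^{i\alpha}}=\psi_j(K_1(t),K_2(t),\dots,K_n(t)),\qquad j=1,2,\dots,n.$$ Here $\psi_1,\dots,\psi_n$ are the expansion coefficients of $N[f]\in I_n$ with respect to $\phi_1,\dots,\phi_n$, i.e. $$N\left[\sum_{j=1}^{n}k_j\phi_j(x)\right]=\sum_{j=1}^{n}\psi_j(k_1,\dots,k_n)\,\phi_j(x)\qquad\text{for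 } k_1,\dots,k_n\in\mathbb{R}.$$
   Context: The Caputo fractional derivative of order $\gamma>0$ of $g\in C^{p}([a,b],\mathbb{R})$ is $$\frac{d^{\gamma}g(t)}{dt^{\gamma}}=\frac{1}{\Gamma(p-\gamma)}\int_a^t\frac{g^{(p)}(\tau)}{(t-\tau)^{\gamma-p+1}}\,d\tau\quad(p-1<\gamma<p),\qquad \frac{d^{\gamma}g(t)}{dt^{\gamma}}=g^{(p)}(t)\quad(\gamma=p),$$ with $p$ a positive integer; $d^{i\alpha}/dt^{i\alpha}$ is the Caputo derivative of order $i\alpha$. Partial Caputo derivatives are Caputo derivatives in the indicated variable with the other variable held fixed. A finite dimensional linear space $I$ of functions of $x$ is invariant with respect to a differential operator $N$ if $N[g]\in I$ for all $g\in I$. The operator $N$ acts in the variable $x$. Here $\mathbb{N}$ in the condition on $r,s$ is understood to include $0$.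
   Formalization: Existence of a solution can fail (K' = 1 + K² on a long interval), so it is not asserted; instead, coefficients K_1,...,K_n solve the system if and only if f = Σ K_j φ_j solves (∗), on compact intervals for x and t. *)

(* Defs.v *)
From HB Require Import structures.
From mathcomp Require Export all_boot all_order all_algebra.
From mathcomp Require Export all_classical all_reals all_analysis.
Export Order.TTheory GRing.Theory Num.Theory.
Export numFieldNormedType.Exports.

Set Implicit Arguments.
Unset Strict Implicit.
Unset Printing Implicit Defensive.

Local Open Scope classical_set_scope.
Local Open Scope ring_scope.

Definition gamma_fun (R : realType) (z : R) : R :=
  (\int[lebesgue_measure]_(u in `]0%R, +oo[) (u `^ (z - 1) * expR (- u)))%R.

(* Functions on [a, b] are represented by total functions R -> R whose values
   outside [a, b] are irrelevant: the limits below are taken inside [a, b], so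
   that derivatives at the endpoints are one-sided. *)
Definition diff_quot (R : realType) (g : R -> R) (x y : R) : R :=
  (g y - g x) / (y - x).

Definition derivable_cc (R : realType) (a b : R) (g : R -> R) (x : R) : Prop :=
  cvg (diff_quot g x @ within `[a, b] x^').

Definition derive_cc (R : realType) (a b : R) (g : R -> R) (x : R) : R :=
  lim (diff_quot g x @ within `[a, b] x^').

Definition deriven_cc (R : realType) (a b : R) (p : nat) (g : R -> R) : R -> R :=
  iter p (derive_cc a b) g.

(* g \in C^p([a, b]); continuity of the derivatives of order < p follows from
   their derivability. *)
Definition Cn_cc (R : realType) (a b : R) (p : nat) (g : R -> R) : Prop :=
  (forall i : nat, (i < p)%N ->
     forall x : R, x \in `[a, b] -> derivable_cc a b (deriven_cc a b i g) x) /\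
  {within `[a, b], continuous (deriven_cc a b p g)}.

(* The integer p with p - 1 < gam <= p, for gam > 0. *)
Definition caputo_deg (R : realType) (gam : R) : nat := `|Num.ceil gam|%N.

Definition caputo_defined (R : realType) (a b gam : R) (g : R -> R) : Prop :=
  Cn_cc a b (caputo_deg gam) g.

(* Caputo derivative of order gam > 0 with base point a of g : [a, b] -> R. *)
Definition caputo (R : realType) (a b gam : R) (g : R -> R) (t : R) : R :=
  let p := caputo_deg gam in
  if gam == p%:R then deriven_cc a b p g t
  else (gamma_fun (p%:R - gam))^-1 *
       (\int[lebesgue_measure]_(tau in `[a, t])
          (deriven_cc a b p g tau / (t - tau) `^ (gam - p%:R + 1)))%R.

(* The operator N[g](x) = F(x, g(x), D^beta g(x), ..., D^(k beta) g(x)) acting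
   on functions on [c, d]; index j : 'I_k stands for the order (j + 1) beta. *)
Definition caputo_operator (R : realType) (c d beta : R) (k : nat)
    (F : R -> R -> ('I_k -> R) -> R) (g : R -> R) (x : R) : R :=
  F x (g x) (fun j => caputo c d (j.+1%:R * beta) g x).

Definition lincomb (R : realType) (n : nat) (phi : 'I_n -> R -> R)
    (v : 'I_n -> R) (x : R) : R :=
  \sum_(j < n) v j * phi j x.

Definition eq_on_cc (R : realType) (c d : R) (g h : R -> R) : Prop :=
  forall x : R, x \in `[c, d] -> g x = h x.

Definition lin_indep_cc (R : realType) (c d : R) (n : nat)
    (phi : 'I_n -> R -> R) : Prop :=
  forall v : 'I_n -> R, eq_on_cc c d (lincomb phi v) (fun=> 0) ->
    forall j, v j = 0.

(* The span of the phi_j, as functions on [c, d]. *)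
Definition span_cc (R : realType) (c d : R) (n : nat)
    (phi : 'I_n -> R -> R) : set (R -> R) :=
  [set g | exists v : 'I_n -> R, eq_on_cc c d g (lincomb phi v)].

Definition invariant_space (R : realType) (N : (R -> R) -> R -> R)
    (I : set (R -> R)) : Prop :=
  forall g, I g -> I (N g).

Definition expansion_coefs (R : realType) (c d : R) (n : nat)
    (phi : 'I_n -> R -> R) (N : (R -> R) -> R -> R)
    (psi : 'I_n -> ('I_n -> R) -> R) : Prop :=
  forall v : 'I_n -> R,
    eq_on_cc c d (N (lincomb phi v)) (lincomb phi (fun j => psi j v)).

(* sum_(1 <= i <= m) lambda_i D^(i alpha) g *)
Definition caputo_sum (R : realType) (a b alpha : R) (m : nat)
    (lambda : 'I_m -> R) (g : R -> R) (t : R) : R :=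
  \sum_(i < m) lambda i * caputo a b (i.+1%:R * alpha) g t.

(* f solves the equation on [c, d] x [a, b] (space x time): all the partial
   Caputo derivatives occurring in it are defined, and it holds pointwise. *)
Definition solves_fpde (R : realType) (a b c d alpha beta : R) (m k : nat)
    (lambda : 'I_m -> R) (F : R -> R -> ('I_k -> R) -> R)
    (f : R -> R -> R) : Prop :=
  [/\ forall x, x \in `[c, d] -> forall i : 'I_m,
        caputo_defined a b (i.+1%:R * alpha) (fun t => f x t),
      forall t, t \in `[a, b] -> forall j : 'I_k,
        caputo_defined c d (j.+1%:R * beta) (fun x => f x t)
    & forall x t, x \in `[c, d] -> t \in `[a, b] ->
        caputo_sum a b alpha lambda (fun t' => f x t') t =
        caputo_operator c d beta F (fun x' => f x' t) x].

Definition solves_system (R : realType) (a b alpha : R) (m n : nat)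
    (lambda : 'I_m -> R) (psi : 'I_n -> ('I_n -> R) -> R)
    (K : 'I_n -> R -> R) : Prop :=
  (forall (j : 'I_n) (i : 'I_m), caputo_defined a b (i.+1%:R * alpha) (K j)) /\
  (forall (j : 'I_n) t, t \in `[a, b] ->
     caputo_sum a b alpha lambda (K j) t = psi j (fun l => K l t)).

(* Main.v *)
(* Caputo differentiation is linear on finite sums of C^p functions; the one
   analytic point is that (t - tau)^(p - 1 - gamma) is integrable on [a, t], so
   that the defining integral may be split. Hence both sides of the equation for
   f = sum_j K_j phi_j lie, at each fixed time, in the span of the phi_j, and
   linear independence lets us compare coefficients. Conversely, linear
   independence also writes each K_j as a linear combination of finitely many
   sections f(x_i, .), so the K_j inherit the time regularity of f. *)
Require Import Defs.
From mathcomp Require Import measurable_realfun ring lra.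

Set Implicit Arguments.
Unset Strict Implicit.
Unset Printing Implicit Defensive.

Local Open Scope classical_set_scope.
Local Open Scope ring_scope.

(** * Integrability of the Caputo kernel *)

(** Because 1 - e > 0, the primitive [G] stays bounded up to t and is nonpositive there, so the
    integrals over [a, [u n]] never exceed -[G a]; monotone convergence then bounds the full
    integral. *)
Lemma integrable_powR_inv (R : realType) (a t e : R) : e < 1 ->
  (@lebesgue_measure R).-integrable `[a, t]
    (EFin \o (fun tau => ((t - tau) `^ e)^-1)).
Proof.
move=> e1.
pose f (tau : R) := ((t - tau) `^ e)^-1.
have fN : f = (fun tau => (t - tau) `^ (- e)).
  by apply/funext => y; rewrite powRN.
have mf D : measurable_fun D f.
  rewrite fN; apply: measurable_funTS.
  apply: (measurableT_comp (@measurable_powR R (- e))).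
  exact: measurable_funB.
have [at_|ta|->] := ltgtP a t; last 2 first.
- by rewrite set_itv_ge ?bnd_simp -?ltNge//; exact: integrable_set0.
- rewrite set_itv1; apply: null_set_integrable => //.
  + by apply/measurable_EFinP; exact: mf.
  + exact: lebesgue_measure_set1.
pose G (tau : R) := - ((t - tau) `^ (1 - e) / (1 - e)).
have f0 tau : 0 <= f tau by rewrite invr_ge0 powR_ge0.
(* The singularity at t is exhausted by [a, u n], on which G is a primitive. *)
pose u (n : nat) := t - (t - a) / n.+2%:R.
have ut n : u n < t by rewrite ltrBlDr ltrDl divr_gt0 ?subr_gt0.
have au n : a < u n.
  rewrite ltrBrDr addrC -ltrBrDr ltr_pdivrMr// ltr_pMr ?subr_gt0//.
  by rewrite ltr1n.
have le_u n p : (n <= p)%N -> u n <= u p.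
  move=> np; rewrite lerD2l lerN2 ler_pM2l ?subr_gt0//.
  by rewrite lef_pV2 ?posrE// ler_nat.
have powRD p x : x < t -> is_derive x 1 (fun tau : R => (t - tau) `^ p)
    (- (p * (t - x) `^ (p - 1))).
  move=> xt; have tx : 0 < t - x by rewrite subr_gt0.
  rewrite -[- (_ * _)]mulrN1.
  have dB : is_derive x 1 (fun tau : R => t - tau) (-1).
    by rewrite -[X in is_derive _ _ _ X]sub0r; exact: is_deriveB.
  exact: (is_derive1_comp (g := fun tau => t - tau) (is_derive1_powR p tx) dB).
have fE tau : tau < t -> is_derive tau 1 G (f tau).
  move=> taut; have e0 : 1 - e != 0 by lra.
  have -> : G = (fun tau => - (1 - e)^-1 * (t - tau) `^ (1 - e)).
    by apply/funext => y; rewrite /G mulrC mulNr.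
  have H := is_deriveZ (- (1 - e)^-1) (powRD (1 - e) _ taut).
  apply: is_derive_eq H _; rewrite /f /GRing.scale/= -powRN.
  rewrite (_ : 1 - e - 1 = - e); last by ring.
  by field.
have FTC n : (\int[lebesgue_measure]_(x in `[a, u n]) (f x)%:E =
   (G (u n))%:E - (G a)%:E)%E.
  have dG x : x <= u n -> derivable G x 1.
    by move=> /le_lt_trans -/(_ _ (ut n)) /fE [].
  have cG x : x <= u n -> {for x, continuous G}.
    by move=> /dG /derivable1_diffP /differentiable_continuous.
  apply: continuous_FTC2 => //.
  + rewrite fN; apply: derivable_within_continuous => x.
    rewrite in_itv/= => /andP[_ xu].
    by have [] := powRD (- e) _ (le_lt_trans xu (ut n)).
  + split.
    * by move=> x; rewrite in_itv/= => /andP[_ /ltW]; exact: dG.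
    * by apply: cvg_at_right_filter; apply: cG; exact: ltW.
    * by apply: cvg_at_left_filter; exact: cG.
  + move=> x; rewrite in_itv/= => /andP[_ /lt_trans -/(_ _ (ut n)) /fE [_ dE]].
    by rewrite derive1E.
apply/integrableP; split; first by apply/measurable_EFinP; exact: mf.
under eq_integral do rewrite /= ger0_norm ?f0//.
rewrite -integral_itv_bndo_bndc; last by apply/measurable_EFinP; exact: mf.
have bc : `[a, t[%classic = \bigcup_n `[a, u n]%classic.
  apply/seteqP; split => [x|x [n _]] /=; rewrite !in_itv/= => /andP[ax];
    last by move=> xu; rewrite ax (le_lt_trans xu).
  (* The inequality x <= [u n] amounts to (t - a) / (t - x) <= n + 2. *)
  move=> xt; exists (Num.bound ((t - a) / (t - x))) => //=.
  rewrite in_itv/= ax /= lerBrDr addrC -lerBrDr.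
  rewrite ler_pdivrMr// mulrC -ler_pdivrMr ?subr_gt0//.
  apply: (le_trans (ltW (archi_boundP _)));
    last by rewrite ler_nat -addn2 leq_addr.
  by rewrite divr_ge0 ?subr_ge0 // ltW.
rewrite bc.
apply: (@le_lt_trans _ _ (- (G a)%:E)%E); last by rewrite -EFinN ltry.
apply: (cvge_le _ (ge0_nondecreasing_set_cvg_integral _ _ _ _)).
- apply: nearW => n; rewrite FTC /G -EFinB -EFinN lee_fin opprK gerDr oppr_le0.
  by rewrite divr_ge0 ?powR_ge0 ?subr_ge0 ?ltW.
- move=> n p np; apply/subsetPset => x /=; rewrite !in_itv/= => /andP[-> /=].
  by move=> /le_trans; apply; exact: le_u.
- by move=> n; exact: measurable_itv.
- by move=> n; apply/measurable_EFinP; exact: mf.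
- by move=> n x _; rewrite lee_fin; exact: f0.
Qed.

(** * Derivatives relative to [a, b] *)

(** Arbitrarily close to x there are other points of [a, b]: on the right if x < b, on the left
    otherwise. Properness gives uniqueness of the limits behind [derive_cc]. *)
Lemma within_dnbhs_itv_proper (R : realType) (a b x : R) : a < b ->
  x \in `[a, b] -> ProperFilter (within `[a, b] x^').
Proof.
move=> ab; rewrite in_itv/= => /andP[ax xb].
apply: Build_ProperFilter_ex => P [e /= e0 eP].
have [ltxb|lebx] := ltP x b.
- have [xy yb] : x < Num.min b (x + e / 2) /\
      Num.min b (x + e / 2) <= x + e / 2.
    by rewrite lt_min ltxb ltrDl divr_gt0// ge_min lexx orbT.
  exists (Num.min b (x + e / 2)); apply: eP.
  + rewrite /ball/= distrC ger0_norm ?subr_ge0; last exact: ltW.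
    by lra.
  + by rewrite gt_eqF.
  + by rewrite in_itv/= ge_min lexx andbT (le_trans ax (ltW xy)).
- have [yx yb] : Num.max a (x - e / 2) < x /\
      x - e / 2 <= Num.max a (x - e / 2).
    rewrite gt_max (lt_le_trans ab lebx) ltrBlDr ltrDl divr_gt0//.
    by rewrite le_max lexx orbT.
  exists (Num.max a (x - e / 2)); apply: eP.
  + rewrite /ball/= ger0_norm ?subr_ge0; last exact: ltW.
    by lra.
  + by rewrite lt_eqF.
  + by rewrite in_itv/= le_max lexx (le_trans (ltW yx) xb).
Qed.

Lemma diff_quot_lincomb (R : realType) (n : nat) (f : 'I_n -> R -> R)
    (v : 'I_n -> R) (x : R) :
  diff_quot (lincomb f v) x = lincomb (fun j => diff_quot (f j) x) v.
Proof.
apply/funext => y; rewrite /diff_quot /lincomb -sumrB mulr_suml.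
by apply: eq_bigr => j _; rewrite -mulrBr mulrA.
Qed.

Lemma cvg_lincomb (R : realType) (T : Type) (F : set_system T) (n : nat)
    (f : 'I_n -> T -> R) (l v : 'I_n -> R) : Filter F ->
  (forall j, f j @ F --> l j) ->
  (fun y => \sum_(j < n) v j * f j y) @ F --> \sum_(j < n) v j * l j.
Proof.
move=> FF fl; apply: (cvg_big (op := +%R) add_continuous) => j _.
by apply: cvgM; [exact: cvg_cst|exact: fl].
Qed.

(** The filter only sees points of [a, b]. This carries the induction on the order of derivation,
    where derivatives of a combination are known on [a, b] only. *)
Lemma eq_diff_quot_fmap (R : realType) (a b : R) (f g : R -> R) (x : R) :
  eq_on_cc a b f g -> x \in `[a, b] ->
  diff_quot f x @ within `[a, b] x^' = diff_quot g x @ within `[a, b] x^'.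
Proof.
move=> fg xab; have E y : y \in `[a, b] -> diff_quot f x y = diff_quot g x y.
  by move=> yab; rewrite /diff_quot !fg.
have H : \forall y \near within `[a, b] x^', diff_quot f x y = diff_quot g x y.
  by rewrite near_withinE; apply: nearW => y yab; rewrite E.
apply/seteqP; split; apply: near_eq_cvg; first exact: H.
by apply: filterS H => y ->.
Qed.

Lemma cvg_diff_quot_lincomb (R : realType) (a b x : R) (n : nat)
    (f : 'I_n -> R -> R) (v : 'I_n -> R) : a < b -> x \in `[a, b] ->
  (forall j, derivable_cc a b (f j) x) ->
  diff_quot (lincomb f v) x @ within `[a, b] x^' -->
    lincomb (fun j => derive_cc a b (f j)) v x.
Proof.
move=> ab xab df; rewrite diff_quot_lincomb.
have FF := within_dnbhs_itv_proper ab xab.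
exact: cvg_lincomb.
Qed.

Lemma deriven_cc_lincomb (R : realType) (a b : R) (n : nat) (f : 'I_n -> R -> R)
    (v : 'I_n -> R) (p : nat) : a < b ->
  (forall j i x, (i < p)%N -> x \in `[a, b] ->
     derivable_cc a b (deriven_cc a b i (f j)) x) ->
  eq_on_cc a b (deriven_cc a b p (lincomb f v))
    (lincomb (fun j => deriven_cc a b p (f j)) v).
Proof.
move=> ab; elim: p => // p IH df x xab.
have {}IH := IH (fun j i x ip => df j i x (ltnW ip)).
rewrite /deriven_cc /= {1}/derive_cc (eq_diff_quot_fmap IH xab).
have FF := within_dnbhs_itv_proper ab xab.
by apply: cvg_lim => //; apply: cvg_diff_quot_lincomb => // j; exact: df.
Qed.

Lemma Cn_cc_lincomb (R : realType) (a b : R) (n : nat) (f : 'I_n -> R -> R)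
    (v : 'I_n -> R) (p : nat) : a < b ->
  (forall j, Cn_cc a b p (f j)) -> Cn_cc a b p (lincomb f v).
Proof.
move=> ab Cf; have df j i x : (i < p)%N -> x \in `[a, b] ->
    derivable_cc a b (deriven_cc a b i (f j)) x.
  by move=> ip xab; case: (Cf j) => + _; exact.
have DE i : (i <= p)%N -> eq_on_cc a b (deriven_cc a b i (lincomb f v))
    (lincomb (fun j => deriven_cc a b i (f j)) v).
  move=> ip; apply: deriven_cc_lincomb => // j k x ki.
  exact/df/(leq_trans ki).
split=> [i ip x xab|].
  rewrite /derivable_cc (eq_diff_quot_fmap (DE i (ltnW ip)) xab).
  by apply/cvgP/cvg_diff_quot_lincomb => // j; exact: df.
apply: (@subspace_eq_continuous _ _ _
  (lincomb (fun j => deriven_cc a b p (f j)) v)).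
  by move=> x; rewrite inE/= => xab; exact/esym/DE.
move=> x; apply: cvg_lincomb => j; case: (Cf j) => _; exact.
Qed.

(** * Linearity of the Caputo derivative *)

Lemma caputo_deg_ge (R : realType) (gam : R) : gam <= (caputo_deg gam)%:R.
Proof.
rewrite /caputo_deg natr_absz (le_trans (ceil_ge _))// ler_int.
exact: ler_norm.
Qed.

(** The exponent is below 1, since [gam] is at most its degree and differs from it. On the compact
    [a, t] the continuous [g] is bounded, so its product with the integrable kernel is
    integrable. *)
Lemma integrable_caputo (R : realType) (a b gam t : R) (g : R -> R) :
  gam != (caputo_deg gam)%:R -> t \in `[a, b] ->
  {within `[a, b], continuous g} ->
  (@lebesgue_measure R).-integrable `[a, t]
    (EFin \o (fun tau => g tau / (t - tau) `^ (gam - (caputo_deg gam)%:R + 1))).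
Proof.
rewrite in_itv/= => gamp /andP[a_t tb] cg.
have cgt : {within `[a, t], continuous g}.
  apply: continuous_subspaceW cg => x /=; rewrite !in_itv/= => /andP[-> xt].
  exact: le_trans tb.
have e1 : gam - (caputo_deg gam)%:R + 1 < 1.
  by rewrite gtrDr subr_lt0 lt_neqAle gamp caputo_deg_ge.
apply: (integrableMr _ _ _ (integrable_powR_inv a t e1)) => //.
- exact: subspace_continuous_measurable_fun.
- have /compact_bounded[M [_ gM]] :=
    continuous_compact cgt (@segment_compact _ a t).
  by exists M; split; rewrite ?num_real // => ? ? ? ?; exact: gM.
Qed.

Lemma caputo_lincomb (R : realType) (a b gam t : R) (n : nat)
    (f : 'I_n -> R -> R) (v : 'I_n -> R) : a < b -> t \in `[a, b] ->
  (forall j, caputo_defined a b gam (f j)) ->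
  caputo a b gam (lincomb f v) t = lincomb (fun j => caputo a b gam (f j)) v t.
Proof.
move=> ab tab Cf.
have DE : eq_on_cc a b (deriven_cc a b (caputo_deg gam) (lincomb f v))
    (lincomb (fun j => deriven_cc a b (caputo_deg gam) (f j)) v).
  by apply: deriven_cc_lincomb => // j i x ip xab; case: (Cf j) => + _; exact.
rewrite /caputo; have [_|gamp] := eqVneq; first exact: DE.
have If j := integrable_caputo gamp tab (proj2 (Cf j)).
transitivity ((gamma_fun ((caputo_deg gam)%:R - gam))^-1 *
    \sum_(j < n) v j * \int[lebesgue_measure]_(tau in `[a, t])
      (deriven_cc a b (caputo_deg gam) (f j) tau /
        (t - tau) `^ (gam - (caputo_deg gam)%:R + 1)))%R.
  congr (_ * _).
  under [RHS]eq_bigr do rewrite -RintegralZl//.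
  (* A real integral is [fine] of an extended one, and [fine] commutes with the sum only because
     every term is finite. *)
  rewrite /Rintegral sum_fine; last first.
    move=> j _; apply: integrable_fin_num => //.
    exact: (@integrableZl _ _ _ _ _ _ (v j) _ (If j)).
  rewrite -integral_sum//; last first.
    by move=> j; exact: (@integrableZl _ _ _ _ _ _ (v j) _ (If j)).
  congr fine; apply: eq_integral => tau.
  rewrite inE/= in_itv/= => /andP[atau taut].
  rewrite DE; last first.
    by move: tab; rewrite !in_itv/= atau => /andP[_ /(le_trans taut)].
  rewrite sumEFin mulr_suml; congr EFin.
  by apply: eq_bigr => j _; rewrite mulrA.
by rewrite /lincomb mulr_sumr; apply: eq_bigr => j _; rewrite mulrCA.
Qed.

(** * Point evaluations dual to the basis *)

(** Coefficients of a function in the span can be read off from its values at finitely many points: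
    once the matrix of the phi_j(x_i) has rank n, [w] is a left inverse of it. *)
Lemma lin_indep_dual (R : realType) (c d : R) (n : nat) (phi : 'I_n -> R -> R) :
  lin_indep_cc c d phi ->
  exists (p : nat) (x : 'I_p -> R) (w : 'I_n -> 'I_p -> R),
    (forall i, x i \in `[c, d]) /\
    forall j l, \sum_(i < p) w j i * phi l (x i) = (j == l)%:R.
Proof.
move=> indep.
pose M p (x : 'I_p -> R) := \matrix_(i < p, j < n) phi j (x i).
suff [p [x [xcd fullM]]] : exists (p : nat) (x : 'I_p -> R),
    (forall i, x i \in `[c, d]) /\ row_full (M p x).
  exists p, x, (fun j i => pinvmx (M p x) j i); split=> // j l.
  have /matrixP/(_ j l) := mulVpmx fullM; rewrite !mxE => <-.
  by apply: eq_bigr => i _; rewrite [M _ _ _ _]mxE.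
(* If M has rank < n, some v != 0 satisfies M v = 0; a point y where
   sum_j v_j phi_j y != 0 gives a new row outside the row space of M. *)
suff H k : (k <= n)%N -> exists (p : nat) (x : 'I_p -> R),
    (forall i, x i \in `[c, d]) /\ (k <= \rank (M p x))%N.
  by have [p [x [xcd]]] := H n (leqnn n); exists p, x; rewrite -col_leq_rank.
elim: k => [_|k IH kn].
  by exists 0%N, (fun=> 0); split=> [[]|].
have [p [x [xcd kM]]] := IH (ltnW kn).
have [kM'|Mk] := ltnP k (\rank (M p x)); first by exists p, x.
have : cokermx (M p x) != 0.
  by rewrite cokermx_eq0 -col_leq_rank -ltnNge (leq_ltn_trans Mk).
move=> /eqP coker0.
have [y [l [ycd phiy]]] : exists y l, y \in `[c, d] /\
    \sum_j cokermx (M p x) j l * phi j y <> 0.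
  apply: contrapT => H; apply: coker0; apply/matrixP => j l; rewrite [RHS]mxE.
  apply: (indep ((cokermx (M p x))^~ l) _ j) => y ycd.
  by apply: contrapT => ?; apply: H; exists y, l.
pose x' (i : 'I_(p + 1)) := if fintype.split i is inl i' then x i' else y.
exists (p + 1)%N, x'; split.
  by move=> i; rewrite /x'; case: fintype.split.
apply: (leq_ltn_trans kM); apply: rank_ltmx; rewrite ltmxE; apply/andP; split.
  apply/row_subP => i; have -> : row i (M p x) = row (lshift 1 i) (M _ x').
    by apply/rowP => j; rewrite !mxE /x' (unsplitK (inl i)).
  exact: row_sub.
(* Inclusion of row spaces would make the product with the cokernel matrix vanish, yet its entry at
   the new row and column l is the nonzero sum at y. *)
apply/negP; rewrite submxE => /eqP/matrixP/(_ (rshift p ord0) l).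
rewrite !mxE => H; apply: phiy; rewrite -[RHS]H; apply: eq_bigr => j _.
by rewrite mulrC [M _ _ _ _]mxE /x' (unsplitK (inr ord0)).
Qed.

(** * Equivalence of the equation and the system *)

(** Solutions of the separated form are characterized by an equivalence with the system; solvability
    of the system itself is not part of the claim. *)
Theorem theorem3p2 (R : realType) (a b c d : R) (hab : a < b) (hcd : c < d)
    (alpha beta : R) (halpha : 0 < alpha) (hbeta : 0 < beta)
    (r s : nat) (hr : Num.floor alpha = r%:Z) (hs : Num.floor beta = s%:Z)
    (m k n : nat) (lambda : 'I_m -> R) (F : R -> R -> ('I_k -> R) -> R)
    (phi : 'I_n -> R -> R)
    (hphi : forall (l : 'I_n) (j : 'I_k),
       caputo_defined c d (j.+1%:R * beta) (phi l))
    (hindep : lin_indep_cc c d phi)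
    (hinv : invariant_space (caputo_operator c d beta F) (span_cc c d phi)) :
  (exists! psi : 'I_n -> ('I_n -> R) -> R,
     expansion_coefs c d phi (caputo_operator c d beta F) psi) /\
  (forall psi : 'I_n -> ('I_n -> R) -> R,
     expansion_coefs c d phi (caputo_operator c d beta F) psi ->
     forall K : 'I_n -> R -> R,
       solves_system a b alpha lambda psi K <->
       solves_fpde a b c d alpha beta lambda F
         (fun x t => \sum_(j < n) K j t * phi j x)).
Proof.
have coords_inj (u v : 'I_n -> R) :
    eq_on_cc c d (lincomb phi u) (lincomb phi v) -> forall j, u j = v j.
  move=> uv j; apply/eqP; rewrite -subr_eq0; apply/eqP.
  apply: (hindep (fun j => u j - v j)) => x xcd; rewrite /lincomb.
  under eq_bigr do rewrite mulrBl.
  by rewrite sumrB -/(lincomb phi u x) -/(lincomb phi v x) uv// subrr.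
split.
  have /choice[psi psiE] : forall v : 'I_n -> R, exists w : 'I_n -> R,
      eq_on_cc c d (caputo_operator c d beta F (lincomb phi v)) (lincomb phi w).
    by move=> v; apply: hinv; exists v.
  exists (fun j v => psi v j); split=> [v|psi' psi'E]; first exact: psiE.
  apply/funext => j; apply/funext => v.
  by apply: (coords_inj (psi v) (psi'^~ v)) => x xcd; rewrite -psiE// psi'E.
move=> psi psiE K.
(* At fixed x the roles are exchanged: the [K j] are the functions combined and the numbers
   [phi j x] the coefficients. *)
have timeE x : (fun t => \sum_(j < n) K j t * phi j x) = lincomb K (phi ^~ x).
  by apply/funext => t; apply: eq_bigr => j _; rewrite mulrC.
have sumE : (forall j (i : 'I_m), caputo_defined a b (i.+1%:R * alpha) (K j)) ->
    forall x t, t \in `[a, b] ->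
    caputo_sum a b alpha lambda (fun t' => \sum_(j < n) K j t' * phi j x) t =
    lincomb phi (fun j => caputo_sum a b alpha lambda (K j) t) x.
  move=> defK x t tab; rewrite /caputo_sum timeE /lincomb.
  under eq_bigr => i _.
    rewrite -/(lincomb _ _) caputo_lincomb// mulr_sumr.
    over.
  rewrite exchange_big; apply: eq_bigr => j _; rewrite mulr_suml.
  by apply: eq_bigr => i _; rewrite mulrCA mulrC.
split=> [[defK sysK]|[deft defx eqf]].
  split=> [x xcd i|t tab j|x t xcd tab].
  - by rewrite timeE; apply: Cn_cc_lincomb => // j; exact: defK.
  - by apply: (Cn_cc_lincomb (K ^~ t)) => // l; exact: hphi.
  (* At fixed t the operator acts on the combination with constant coefficients K_j(t), so [psi]
     gives its expansion. *)
  - rewrite sumE// (psiE (K ^~ t))//.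
    by apply: eq_bigr => j _; rewrite sysK.
(* Only the sections f(x, .) are known to be regular; the dual points recover each K_j as a
   combination of the sections at the x_q with weights [w j]. *)
have [p [x [w [xcd wE]]]] := lin_indep_dual hindep.
have defK j (i : 'I_m) : caputo_defined a b (i.+1%:R * alpha) (K j).
  have -> : K j = lincomb (fun q t => \sum_(l < n) K l t * phi l (x q)) (w j).
    apply/funext => t; rewrite /lincomb.
    under eq_bigr do rewrite mulr_sumr.
    rewrite exchange_big/=.
    under eq_bigr => l _.
      under eq_bigr do rewrite mulrCA.
      rewrite -mulr_sumr wE.
      over.
    rewrite (bigD1 j)//= eqxx mulr1 big1 ?addr0// => l lj.
    by rewrite eq_sym (negbTE lj) mulr0.
  by apply: Cn_cc_lincomb => // q; exact: deft.
split=> // j t tab.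
(* With t fixed, both sides of the equation are elements of the span with these coordinates. *)
apply: (coords_inj (fun l => caputo_sum a b alpha lambda (K l) t)
  (fun l => psi l (K ^~ t))) => y ycd.
by rewrite -sumE// eqf// -psiE.
Qed.
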